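(* Let $k\ge 1$ be a fixed integer. For integers $n\ge 2^k$, let $\mathcal{L}_n$ be the set of integers between $1$ and $n$ that are not divisible by $2^k$. Then $$f_{\mathcal{L}_n}(n)=(2+o(1))\binom{n}{2^{k-1}-1}\quad\text{as } n\to\infty.$$
   Context: For a set $\mathcal{L}$ of positive integers, $f_{\mathcal{L}}(n)$ denotes the maximum number of vectors in $\{0,1\}^n$ such that the Hamming distance between any two distinct ones lies in $\mathcal{L}$. The Hamming distance between two vectors is the number of coordinates in which they differ. *)

(* Defs.v *)
From HB Require Import structures.
From mathcomp Require Import all_boot all_order all_algebra.

Set Implicit Arguments.
Unset Strict Implicit.
Unset Printing Implicit Defensive.

Definition hamming_dist (n : nat) (x y : {ffun 'I_n -> bool}) : nat :=
  #|[set i : 'I_n | x i != y i]|.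

Definition has_distances_in (L : pred nat) (n : nat)
    (A : {set {ffun 'I_n -> bool}}) : bool :=
  [forall x in A, forall y in A, (x != y) ==> L (hamming_dist x y)].

(* The maximum is over a nonempty family: set0 satisfies has_distances_in. *)
Definition max_code_size (L : pred nat) (n : nat) : nat :=
  \max_(A : {set {ffun 'I_n -> bool}} | has_distances_in L A) #|A|.

Definition nonmultiples_upto (d n : nat) : pred nat :=
  fun m => (1 <= m <= n) && ~~ (d %| m).

(* Main.v *)
(** Vectors whose weights have different parities are at odd distance, so the
two parity classes of a code can be treated separately.  Inside a class put
[d = 2 h], [s + 1 = 2 ^ (k - 1)].  The integer ['C(h + s, s)] is odd for [h = 0]
and even when [2 ^ (k - 1)] does not divide [h], so the matrix of these numbers
is invertible; as [d] is affine in the coordinates of either argument, its rank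
is at most the number of squarefree monomials of degree at most [s].
Conversely, the vectors of weight [s], together with their translates by a unit
vector, form a code of size [2 'C(n, s)]. *)
Require Import Defs.
From HB Require Import structures.
From mathcomp Require Import all_boot all_order all_algebra.
From mathcomp Require Import all_classical all_reals all_analysis.
From mathcomp Require Import zify ring.
Import Order.TTheory GRing.Theory Num.Theory.
Import numFieldNormedType.Exports.

Set Implicit Arguments.
Unset Strict Implicit.
Unset Printing Implicit Defensive.

Local Open Scope classical_set_scope.
Local Open Scope ring_scope.

(** * Parity of determinants and of binomial coefficients *)

Lemma mxrank_odd_diag (m : nat) (N : 'I_m -> 'I_m -> nat) :
  (forall i j, odd (N i j) = (i == j)) ->
  \rank (\matrix_(i, j) (N i j)%:R : 'M[rat]_m) = m.
Proof.
move=> oddN; apply/mxrank_unit; rewrite unitmxE unitfE.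
(* The determinant is an integer, so it can be reduced modulo 2, where the matrix becomes the
   identity; hence it is odd and nonzero over [rat]. *)
pose Z : 'M[int]_m := \matrix_(i, j) (N i j)%:R.
have -> : \matrix_(i, j) (N i j)%:R = map_mx intr Z :> 'M[rat]_m.
  by apply/matrixP => i j; rewrite !mxE rmorph_nat.
rewrite det_map_mx intr_eq0; apply/eqP => detZ0.
have : \det (map_mx (intr : int -> 'F_2) Z) = 1.
  rewrite -[RHS](det1 _ m); congr (\det _); apply/matrixP => i j.
  rewrite !mxE rmorph_nat -oddN -[in LHS](odd_double_half (N i j)).
  by rewrite natrD -muln2 natrM [2%:R](_ : _ = 0) ?mulr0 ?addr0 //; apply/val_inj.
by rewrite det_map_mx detZ0 rmorph0.
Qed.

(** Since [h * 'C(h + s, s) = s.+1 * 'C(h + s, s.+1)], the power [2 ^ j] divides the left side; an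
    odd binomial would be coprime to it and force [2 ^ j] to divide [h]. *)
Lemma even_bin_addn (j h s : nat) : s.+1 = (2 ^ j)%N -> ~~ (2 ^ j %| h)%N ->
  ~~ odd 'C(h + s, s).
Proof.
move=> sE; apply: contra => oddC.
have : (2 ^ j %| h * 'C(h + s, s))%N.
  by rewrite -{1}(addnK s h) -mul_bin_left sE dvdn_mulr.
by rewrite Gauss_dvdl // coprimeXl // coprime2n.
Qed.

(** * Weights and Hamming distances *)

Definition weight (n : nat) (x : {ffun 'I_n -> bool}) : nat :=
  #|[set i : 'I_n | x i]%SET|.

Lemma card_set_sum (T : finType) (P : pred T) :
  (#|[set i | P i]%SET| = \sum_i P i)%N.
Proof. by rewrite -sum1dep_card big_mkcond; apply: eq_bigr => i _; case: (P i). Qed.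

Lemma hamming_dist_weight (n : nat) (x y : {ffun 'I_n -> bool}) :
  (hamming_dist x y + (#|[set i : 'I_n | x i && y i]%SET|).*2
   = weight x + weight y)%N.
Proof.
rewrite /hamming_dist /weight -addnn !card_set_sum -!big_split.
by apply: eq_bigr => i _ /=; case: (x i); case: (y i).
Qed.

Lemma odd_hamming_dist (n : nat) (x y : {ffun 'I_n -> bool}) :
  odd (hamming_dist x y) = odd (weight x) (+) odd (weight y).
Proof.
by rewrite -oddD -hamming_dist_weight oddD odd_double addbF.
Qed.

Lemma hamming_dist_eq0 (n : nat) (x y : {ffun 'I_n -> bool}) :
  (hamming_dist x y == 0)%N = (x == y).
Proof.
rewrite cards_eq0; apply/eqP/eqP => [/setP d0 | ->].
  by apply/ffunP => i; have := d0 i; rewrite !inE => /negbFE/eqP.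
by apply/setP => i; rewrite !inE eqxx.
Qed.

Lemma hamming_dist_le (n : nat) (x y : {ffun 'I_n -> bool}) :
  (hamming_dist x y <= n)%N.
Proof. by rewrite -{2}(card_ord n) max_card. Qed.

(** For bits [a] and [b], the indicator of [a != b] is [a + b - 2ab], which is affine in [b] once
    [a] is fixed. *)
Lemma hamming_dist_affine (n : nat) (x y : {ffun 'I_n -> bool}) :
  (hamming_dist x y)%:R =
  (weight x)%:R + \sum_(l < n) (1 - (x l)%:R *+ 2) * (y l)%:R :> rat.
Proof.
rewrite /hamming_dist /weight !card_set_sum !natr_sum -big_split.
by apply: eq_bigr => l _ /=; case: (x l); case: (y l) => /=; ring.
Qed.

(** * Expansion in squarefree monomials *)

Definition small_sets (n s : nat) : {set {set 'I_n}} :=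
  [set S : {set 'I_n} | (#|S| <= s)%N]%SET.

Lemma card_small_sets (n s : nat) :
  #|small_sets n s| = (\sum_(i < s.+1) 'C(n, i))%N.
Proof.
rewrite -sum1dep_card.
(* Sizes above [s] would be sent to 0 by [inord], but the condition [#|S| <= s] survives in every
   class and excludes them. *)
rewrite (partition_big (fun S : {set 'I_n} => inord #|S| : 'I_s.+1) xpredT) //=.
apply: eq_bigr => i _; rewrite sum1dep_card -[n in RHS]card_ord -card_draws.
apply: eq_card => S; rewrite !inE -val_eqE /=.
case: leqP => [leS|gtS] /=; first by rewrite inordK.
by apply/esym/gtn_eqF/(leq_trans _ gtS).
Qed.

(** In the expansion of a product of [s] affine forms, [f] records the summand taken from each
    factor: [None] is the constant, [Some l] the variable [l]. *)
Definition named_vars (n s : nat) (f : {ffun 'I_s -> option 'I_n}) : {set 'I_n} :=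
  [set l | Some l \in codom f]%SET.

Lemma card_named_vars (n s : nat) (f : {ffun 'I_s -> option 'I_n}) :
  (#|named_vars f| <= s)%N.
Proof.
rewrite -(card_imset _ (@Some_inj _)).
apply: (@leq_trans #|codom f|); last first.
  by rewrite (leq_trans (card_size _)) // size_codom card_ord.
by apply/subset_leq_card/fintype.subsetP => _ /imsetP[l lf ->]; rewrite inE in lf.
Qed.

(* Coordinates are 0 or 1, so a product of coordinates only depends on the set
   of the variables occurring in it. *)
Lemma prod_coord (n s : nat) (f : {ffun 'I_s -> option 'I_n})
    (y : {ffun 'I_n -> bool}) :
  \prod_(i < s) (if f i is Some l then (y l)%:R else 1) =
  \prod_(l in named_vars f) (y l)%:R :> rat.
Proof.
have [ally | ] := boolP [forall l in named_vars f, y l].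
  rewrite !big1 // => [l lf | i _]; first by rewrite (forall_inP ally).
  case fi: (f i) => [l|] //; rewrite (forall_inP ally) // inE -fi.
  exact: codom_f.
rewrite negb_forall_in => /exists_inP[l lf /negbTE yl].
rewrite [RHS](bigD1 l) //= yl mul0r.
move: lf; rewrite inE => /codomP[i fi].
by rewrite (bigD1 i) //= -fi yl mul0r.
Qed.

(** Distribute the product over all choices [f], then collect the terms that share the same set of
    variables; repeated variables collapse on 0/1 vectors. *)
Lemma prod_affine_monomials (n s : nat) (c : 'I_s -> option 'I_n -> rat) :
  exists u : {set 'I_n} -> rat, forall y : {ffun 'I_n -> bool},
    \prod_(i < s) (c i None + \sum_(l < n) c i (Some l) * (y l)%:R) =
    \sum_(S in small_sets n s) u S * \prod_(l in S) (y l)%:R.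
Proof.
exists (fun S => \sum_(f : {ffun 'I_s -> option 'I_n} | named_vars f == S)
                   \prod_(i < s) c i (f i)) => y.
transitivity (\prod_(i < s) \sum_(o : option 'I_n)
                c i o * (if o is Some l then (y l)%:R else 1)).
  apply: eq_bigr => i _; rewrite (bigD1 None) //= mulr1; congr (_ + _).
  rewrite (reindex_omap Some id) //=; last by case.
  by apply: eq_bigl => l; rewrite eqxx.
rewrite bigA_distr_bigA /=.
rewrite (partition_big (@named_vars n s) (mem (small_sets n s))) /=; last first.
  by move=> f _; rewrite inE card_named_vars.
apply: eq_bigr => S _; rewrite mulr_suml; apply: eq_bigr => f /eqP <-.
by rewrite big_split prod_coord.
Qed.

(** For even [d], [s]! times the binomial is the product of the [s] factors [d / 2 + (s - i)], each
    affine in [y]. The coefficients are rational because of the halving and of the division by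
    [s]!. *)
Lemma bin_half_dist_monomials (n s : nat) (x : {ffun 'I_n -> bool}) :
  exists u : {set 'I_n} -> rat, forall y : {ffun 'I_n -> bool},
    ~~ odd (hamming_dist x y) ->
    'C((hamming_dist x y)./2 + s, s)%:R =
    \sum_(S in small_sets n s) u S * \prod_(l in S) (y l)%:R.
Proof.
pose c (i : 'I_s) (o : option 'I_n) : rat :=
  if o is Some l then (1 - (x l)%:R *+ 2) / 2
  else (weight x)%:R / 2 + (s - i)%:R.
have [u uE] := prod_affine_monomials c.
exists (fun S => (s`!%:R)^-1 * u S) => y evd.
under eq_bigr do rewrite -mulrA.
rewrite -mulr_sumr -uE; apply: (@mulfI _ (s`!%:R)).
  by rewrite pnatr_eq0 -lt0n fact_gt0.
rewrite mulVKf ?pnatr_eq0 -?lt0n ?fact_gt0 //.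
rewrite -natrM mulnC bin_ffact ffact_prod natr_prod.
apply: eq_bigr => i _ /=.
rewrite -addnBA ?(ltnW (ltn_ord i)) // natrD.
have -> : (hamming_dist x y)./2%:R = (hamming_dist x y)%:R / 2 :> rat.
  by rewrite -[in RHS](even_halfK evd) -muln2 natrM mulfK.
rewrite hamming_dist_affine mulrDl mulr_suml addrAC; congr (_ + _).
by apply: eq_bigr => l _; rewrite mulrAC.
Qed.

(** * Upper bound by matrix rank *)

Lemma card_even_code (n j s : nat) (A : {set {ffun 'I_n -> bool}}) :
  s.+1 = (2 ^ j)%N ->
  {in A &, forall x y, ~~ odd (hamming_dist x y)} ->
  {in A &, forall x y, x != y -> ~~ (2 ^ j.+1 %| hamming_dist x y)%N} ->
  (#|A| <= #|small_sets n s|)%N.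
Proof.
move=> sE evA ndvd.
pose N (a b : 'I_#|A|) :=
  'C((hamming_dist (enum_val a) (enum_val b))./2 + s, s).
have oddN a b : odd (N a b) = (a == b).
  rewrite /N; have [->|neab] := eqVneq a b.
    have /eqP-> : hamming_dist (enum_val b) (enum_val b) == 0%N.
      by rewrite hamming_dist_eq0.
    by rewrite add0n binn.
  (* As the distance is even, its half is divisible by [2 ^ j] only if the distance itself is
     divisible by [2 ^ j.+1]. *)
  apply/negbTE/(even_bin_addn sE).
  have := ndvd _ _ (enum_valP a) (enum_valP b).
  rewrite (inj_eq enum_val_inj) neab => /(_ isT).
  rewrite -{1}(even_halfK (evA _ _ (enum_valP a) (enum_valP b))).
  by rewrite -mul2n expnS dvdn_pmul2l.
have /fin_all_exists[u uE] := fun a : 'I_#|A| =>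
  bin_half_dist_monomials s (enum_val a).
(* The matrix factors through the monomials: [U] holds coefficients, [V] the values of the monomials
   at the codewords. *)
pose U : 'M[rat]_(#|A|, #|small_sets n s|) := \matrix_(a, t) u a (enum_val t).
pose V : 'M[rat]_(#|small_sets n s|, #|A|) :=
  \matrix_(t, b) \prod_(l in (enum_val t : {set 'I_n}))
    ((enum_val b : {ffun 'I_n -> bool}) l)%:R.
rewrite -[leqLHS](mxrank_odd_diag oddN).
have -> : \matrix_(a, b) (N a b)%:R = U *m V.
  apply/matrixP => a b; rewrite !mxE uE ?evA ?enum_valP //.
  by rewrite big_enum_val; apply: eq_bigr => t _; rewrite !mxE.
by rewrite (leq_trans (mxrankM_maxl _ _)) // rank_leq_col.
Qed.

Lemma max_code_size_le (n j s : nat) : s.+1 = (2 ^ j)%N ->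
  (max_code_size (nonmultiples_upto (2 ^ j.+1) n) n
   <= 2 * \sum_(i < s.+1) 'C(n, i))%N.
Proof.
move=> sE; apply/bigmax_leqP => A /forall_inP codeA.
have ndvd : {in A &, forall x y, x != y -> ~~ (2 ^ j.+1 %| hamming_dist x y)%N}.
  move=> x y xA yA nexy.
  by have /forall_inP/(_ y yA) := codeA x xA; rewrite nexy => /andP[].
rewrite -card_small_sets mul2n -addnn.
rewrite -(cardsID [set x : {ffun 'I_n -> bool} | odd (weight x)]%SET A).
apply: leq_add; apply: (card_even_code sE).
- move=> x y; rewrite !inE => /andP[_ ox] /andP[_ oy].
  by rewrite odd_hamming_dist ox oy.
- by move=> x y /finset.setIP[xA _] /finset.setIP[yA _]; apply: ndvd.
- move=> x y; rewrite !inE => /andP[/negbTE ox _] /andP[/negbTE oy _].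
  by rewrite odd_hamming_dist ox oy.
- by move=> x y /finset.setDP[xA _] /finset.setDP[yA _]; apply: ndvd.
Qed.

(** * Lower bound by an explicit code *)

Definition flip (n : nat) (i : 'I_n) (x : {ffun 'I_n -> bool}) :
    {ffun 'I_n -> bool} :=
  [ffun l => x l (+) (l == i)].

Lemma flipK (n : nat) (i : 'I_n) : involutive (flip i).
Proof. by move=> x; apply/ffunP => l; rewrite !ffunE addbK. Qed.

Lemma hamming_dist_flip (n : nat) (i : 'I_n) (x y : {ffun 'I_n -> bool}) :
  hamming_dist (flip i x) (flip i y) = hamming_dist x y.
Proof.
by apply: eq_card => l; rewrite !inE !ffunE (inj_eq (@addIb _)).
Qed.

Lemma odd_weight_flip (n : nat) (i : 'I_n) (x : {ffun 'I_n -> bool}) :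
  odd (weight (flip i x)) = ~~ odd (weight x).
Proof.
have : odd (hamming_dist (flip i x) x).
  rewrite (_ : hamming_dist _ _ = 1%N) // -(cards1 i); apply: eq_card => l.
  by rewrite !inE !ffunE; case: (x l); case: (l == i).
by rewrite odd_hamming_dist; case: odd; case: odd.
Qed.

Definition weight_class (n s : nat) : {set {ffun 'I_n -> bool}} :=
  [set x | weight x == s]%SET.

Lemma card_weight_class (n s : nat) : #|weight_class n s| = 'C(n, s).
Proof.
pose f (S : {set 'I_n}) : {ffun 'I_n -> bool} := [ffun l => l \in S].
have fK : cancel f (fun x => [set l | x l]%SET).
  by move=> S; apply/setP => l; rewrite inE ffunE.
rewrite -[n in RHS]card_ord -card_draws -(card_imset _ (can_inj fK)).
apply: eq_card => x; rewrite inE; apply/eqP/imsetP => [wx | [S]].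
  exists [set l | x l]%SET; first by rewrite inE; apply/eqP.
  by apply/ffunP => l; rewrite ffunE inE.
by rewrite inE => /eqP <- ->; rewrite /weight (fK S).
Qed.

(** Distances inside the class are positive and at most [2s], which is below [2 ^ j.+1 = 2s + 2]. *)
Lemma weight_class_dist (n j s : nat) : s.+1 = (2 ^ j)%N ->
  {in weight_class n s &, forall x y,
    x != y -> nonmultiples_upto (2 ^ j.+1) n (hamming_dist x y)}.
Proof.
move=> sE x y; rewrite !inE => /eqP wx /eqP wy nexy.
have dgt0 : (0 < hamming_dist x y)%N by rewrite lt0n hamming_dist_eq0.
rewrite /nonmultiples_upto dgt0 hamming_dist_le /=.
have dE := hamming_dist_weight x y; rewrite wx wy in dE.
by apply/negP => /(dvdn_leq dgt0); rewrite expnS -sE; lia.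
Qed.

Lemma max_code_size_ge (n j s : nat) : s.+1 = (2 ^ j)%N -> (0 < n)%N ->
  (2 * 'C(n, s) <= max_code_size (nonmultiples_upto (2 ^ j.+1) n) n)%N.
Proof.
move=> sE n_gt0; pose i := Ordinal n_gt0.
pose A := weight_class n s; pose B := (flip i @: A)%SET.
have parA x : x \in A -> odd (weight x) = odd s by rewrite inE => /eqP->.
have parB x : x \in B -> odd (weight x) = ~~ odd s.
  by case/imsetP => y yA ->; rewrite odd_weight_flip parA.
(* Across the two halves of the code the distance is odd, hence nonzero and no multiple of an even
   number. *)
have odd_dist (x y : {ffun 'I_n -> bool}) : odd (weight x) != odd (weight y) ->
    nonmultiples_upto (2 ^ j.+1) n (hamming_dist x y).
  move=> nexy; have od : odd (hamming_dist x y).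
    by rewrite odd_hamming_dist; move: nexy; case: odd; case: odd.
  rewrite /nonmultiples_upto hamming_dist_le odd_gt0 //=.
  apply: contraL od => /(dvdn_trans _) d2.
  by rewrite -dvdn2 d2 // dvdn_exp.
have disjAB : (A :&: B = finset.set0)%SET.
  apply/setP => x; rewrite finset.in_setI finset.in_set0.
  by apply/negP => /andP[/parA pA /parB]; rewrite pA; case: odd.
have -> : (2 * 'C(n, s) = #|A :|: B|%SET)%N.
  rewrite cardsU disjAB cards0 subn0.
  by rewrite (card_imset _ (can_inj (flipK i))) card_weight_class mul2n addnn.
apply: (@leq_bigmax_cond _ _ (fun C : {set {ffun 'I_n -> bool}} => #|C|)).
apply/forall_inP => x xAB; apply/forall_inP => y yAB; apply/implyP => nexy.
case/finset.setUP: xAB => hx; case/finset.setUP: yAB => hy.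
- exact: (weight_class_dist sE hx hy nexy).
- by apply: odd_dist; rewrite (parA _ hx) (parB _ hy); case: odd.
- by apply: odd_dist; rewrite (parB _ hx) (parA _ hy); case: odd.
case/imsetP: hx nexy => x' x'A ->; case/imsetP: hy => y' y'A -> nexy.
rewrite hamming_dist_flip; apply: (weight_class_dist sE x'A y'A).
by apply: contraNneq nexy => ->.
Qed.

(** * Asymptotics *)

Lemma leq_bin2r_half (n i s : nat) : (i <= s)%N -> (s.*2 <= n)%N ->
  ('C(n, i) <= 'C(n, s))%N.
Proof.
elim: s => [|s IHs]; first by rewrite leqn0 => /eqP->.
rewrite leq_eqVlt => /predU1P[-> // | lt_is] le_sn.
apply: (leq_trans (IHs lt_is _)); first by lia.
rewrite -(leq_pmul2l (ltn0Sn s)) mul_bin_left leq_mul2r; apply/orP; right; lia.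
Qed.

(** The terms below the top one are negligible: for [i < s], [n.+1 <= 2 * (n - i)] and [(n - i) *
    'C(n, i) = i.+1 * 'C(n, i.+1) <= s * 'C(n, s)]. *)
Lemma sum_bin_lt (n s : nat) : (s.*2 < n)%N ->
  (n.+1 * \sum_(i < s) 'C(n, i) <= 2 * s ^ 2 * 'C(n, s))%N.
Proof.
move=> lt_sn; rewrite big_distrr /=.
have -> : (2 * s ^ 2 * 'C(n, s) = \sum_(i < s) 2 * s * 'C(n, s))%N.
  by rewrite sum_nat_const card_ord; ring.
apply: leq_sum => i _; have lt_is := ltn_ord i.
apply: (@leq_trans (2 * ((n - i) * 'C(n, i)))).
  by rewrite mulnA leq_mul2r; apply/orP; right; lia.
rewrite -mul_bin_left -mulnA leq_mul2l /= leq_mul // leq_bin2r_half //; lia.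
Qed.

Theorem theorem8 (R : realType) (k : nat) (hk : (1 <= k)%N) :
  exists e : nat -> R,
    e n @[n --> \oo] --> (0 : R) /\
    forall n : nat, (2 ^ k <= n)%N ->
      (max_code_size (nonmultiples_upto (2 ^ k) n) n)%:R
      = (2 + e n) * 'C(n, 2 ^ (k - 1) - 1)%:R :> R.
Proof.
case: k hk => // j _; rewrite [(j.+1 - 1)%N]subn1 /=.
set s := (2 ^ j - 1)%N.
have sE : s.+1 = (2 ^ j)%N by rewrite /s subn1 prednK // expn_gt0.
pose M n := max_code_size (nonmultiples_upto (2 ^ j.+1) n) n.
have big_n n : (2 ^ j.+1 <= n)%N -> (s.*2.+1 < n)%N.
  by rewrite expnS -sE; lia.
have bin_gt n : (2 ^ j.+1 <= n)%N -> (0 : R) < 'C(n, s)%:R.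
  by move=> /big_n nn; rewrite ltr0n bin_gt0; lia.
exists (fun n => (M n)%:R / 'C(n, s)%:R - 2); split; last first.
  by move=> n /bin_gt/gt_eqF C0; rewrite addrC subrK divfK ?C0.
(* The explicit code makes the error nonnegative. The upper bound makes it at most
   [4 * s ^ 2 / n.+1], twice the constant of [sum_bin_lt] because there are two parity classes. *)
apply: (@squeeze_cvgr _ _ _ _ (fun=> 0)
          (fun n => (4 * s ^ 2)%N%:R * harmonic n)); first 1 last.
- exact: cvg_cst.
- by rewrite -[X in _ --> X](mulr0 (4 * s ^ 2)%N%:R); apply: cvgMr; apply: cvg_harmonic.
exists (2 ^ j.+1)%N => // n /= le_n.
have C0 := bin_gt _ le_n; have nn := big_n _ le_n.
rewrite subr_ge0 ler_pdivlMr // -natrM ler_nat max_code_size_ge //=; last by lia.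
rewrite lerBlDr ler_pdivrMr // /harmonic /=.
have n1 : (0 : R) < n.+1%:R by rewrite ltr0n.
rewrite -(ler_pM2l n1) mulrA mulrDr mulrCA divff ?gt_eqF // mulr1.
rewrite -!natrM -natrD -natrM ler_nat.
apply: (leq_trans (leq_mul (leqnn _) (max_code_size_le n sE))).
(* The term [i = s] gives the main term [2 * 'C(n, s)]; the others go into the error. *)
rewrite big_ord_recr /= mulnDr mulnDr mulnDl leq_add //; last by rewrite mulnA.
have := sum_bin_lt (ltnW nn); set t := (\sum_(i < s) _)%N; nia.
Qed.
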